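(* Let $(m_1,k_1)$ and $(m_2,k_2)$ be admissible parameters with $m_1/k_1<m_2/k_2$ that are Farey-adjacent, i.e. $m_2k_1-m_1k_2=1$, and put $(m,k)=(m_1+m_2,\,k_1+k_2)$. Write $s^{(1)}_j=jm_1\bmod k_1$ ($0\le j\le k_1-1$), $s^{(2)}_i=im_2\bmod k_2$ ($0\le i\le k_2-1$), and $s_j=jm\bmod k$ ($0\le j\le k-1$). Then: (a) for all $0\le j\le k_1-1$, the integer $k\,s^{(1)}_j+j$ is divisible by $k_1$, and $$s_j=\frac{k\,s^{(1)}_j+j}{k_1},\qquad \left\lfloor \frac{jm}{k}\right\rfloor=\left\lfloor\frac{jm_1}{k_1}\right\rfloor;$$ (b) for all $0\le i\le k_2-1$, the integer $k\,s^{(2)}_i-i$ is divisible by $k_2$, and $$s_{k_1+i}=1+\frac{k\,s^{(2)}_i-i}{k_2};$$ (c) for all $0\le i\le k_2$, $$\left\lfloor \frac{(k_1+i)m}{k}\right\rfloor=m_1+\left\lfloor\frac{im_2}{k_2}\right\rfloor;$$ (d) moreover, $k_1m-m_1k=m_2k_1-m_1k_2=1$.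
   Context: An admissible parameter is a pair of integers $(m,k)$ that either satisfies $0<m<k$ and $\gcd(m,k)=1$ (a reduced fraction $0<m/k<1$), or is one of the two formal seeds $(0,1)$, $(1,1)$. For integers $a$ and $k\ge1$, $a\bmod k$ denotes the remainder in $\{0,\dots,k-1\}$. The numbers $s_j=jm\bmod k$ are called the direction indices of $(m,k)$. *)

(* Defs.v *)
From mathcomp Require Import all_boot all_order all_algebra.

Set Implicit Arguments.
Unset Strict Implicit.
Unset Printing Implicit Defensive.

Import Order.TTheory GRing.Theory Num.Theory.
Local Open Scope ring_scope.

Definition admissible (m k : int) : Prop :=
  (0 < m /\ m < k /\ gcdz m k = 1) \/ (m = 0 /\ k = 1) \/ (m = 1 /\ k = 1).

Definition qratio (a b : int) : rat := a%:Q / b%:Q.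

Definition farey_adjacent (m1 k1 m2 k2 : int) : Prop :=
  m2 * k1 - m1 * k2 = 1.

(* For k >= 1, (a %% k)%Z is the remainder in {0, ..., k-1}. *)
Definition dir_index (m k j : int) : int := (j * m %% k)%Z.

(* Main.v *)
Require Import Defs.
From mathcomp Require Import all_boot all_order all_algebra.
From mathcomp Require Import zify ring.

Set Implicit Arguments.
Unset Strict Implicit.
Unset Printing Implicit Defensive.

Import Order.TTheory GRing.Theory Num.Theory.
Local Open Scope ring_scope.

(** With [m = m1 + m2] and [k = k1 + k2], Farey adjacency gives the two
    mediant identities [k1 * m = m1 * k + 1] and [k2 * m = m2 * k - 1]. Write
    [j * m1 = q * k1 + s] with [0 <= s < k1]. Multiplying [j * m] by [k1] and
    using the first identity yields [k1 * (j * m - q * k) = k * s + j], so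
    [t = j * m - q * k] is the integer [(k * s + j) / k1]; the bounds on [s] and
    [j] give [0 <= t < k], so [q] and [t] are the quotient and remainder of
    [j * m] by [k]. In the same way [i * m2 = q * k2 + s] and the second identity
    give [k2 * (i * m - q * k) = k * s - i], and adding [k1 * m = m1 * k + 1]
    shows that [(k1 + i) * m] has quotient [m1 + q] and remainder [1 + u] with
    [u = (k * s - i) / k2]. The extra 1 is what makes this remainder
    nonnegative. The lemmas [mediant_left_division] and
    [mediant_right_division] carry out these two computations; floors of
    fractions are Euclidean quotients by [floor_qratio]. *)

Lemma euclid_unique (q d r : int) : 0 <= r -> r < d ->
  ((q * d + r) %/ d)%Z = q /\ ((q * d + r) %% d)%Z = r.
Proof.
move=> r_ge0 r_lt_d; have d_neq0 : d != 0 by lia.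
have d_gt0 : 0 < d by lia.
split; last by rewrite modzMDl modz_small // r_ge0.
by rewrite divzMDl // divz_small ?addr0 //; lia.
Qed.

Lemma floor_qratio (a b : int) : 0 < b -> Num.floor (qratio a b) = (a %/ b)%Z.
Proof.
move=> b_gt0; apply: floor_def; rewrite /qratio.
have bQ_gt0 : 0 < b%:Q by rewrite ltr0z.
rewrite ler_pdivlMr // ltr_pdivrMr // -!intrM ler_int ltr_int.
have := divz_eq a b; have := modz_ge0 a (lt0r_neq0 b_gt0).
have := ltz_pmod a b_gt0; lia.
Qed.

Lemma qratio_mulKl (d t : int) : 0 < d -> qratio (d * t) d = t%:Q.
Proof.
by move=> d_gt0; rewrite /qratio intrM mulrC mulKf // intr_eq0 lt0r_neq0.
Qed.

Lemma admissible_gt0 (m k : int) : admissible m k -> 0 < k.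
Proof. by rewrite /admissible; lia. Qed.

Section Mediant.

Variables m1 k1 m2 k2 : int.
Hypotheses (k1_gt0 : 0 < k1) (k2_gt0 : 0 < k2).
Hypothesis adj : farey_adjacent m1 k1 m2 k2.

Let m := m1 + m2.
Let k := k1 + k2.

Lemma mediant_left : k1 * m = m1 * k + 1.
Proof. by move: adj; rewrite /farey_adjacent /m /k; lia. Qed.

Lemma mediant_right : k2 * m = m2 * k - 1.
Proof. by move: adj; rewrite /farey_adjacent /m /k; lia. Qed.

(** Since [m / k] exceeds [m1 / k1] by only [1 / (k * k1)], for [j < k1] the
    gap between [j * m / k] and [j * m1 / k1] is below [1 / k1], while the
    next integer above [j * m1 / k1] is at least [1 / k1] away: the quotient
    does not change. *)
Lemma mediant_left_division (j : int) : 0 <= j -> j < k1 ->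
  exists t : int, [/\ k * dir_index m1 k1 j + j = k1 * t,
    (j * m %/ k)%Z = (j * m1 %/ k1)%Z & dir_index m k j = t].
Proof.
move=> j_ge0 j_lt; rewrite /dir_index.
have := divz_eq (j * m1) k1; have := modz_ge0 (j * m1) (lt0r_neq0 k1_gt0).
have := ltz_pmod (j * m1) k1_gt0.
move: (_ %/ k1)%Z (_ %% k1)%Z => q s s_lt s_ge0 jm1E.
pose t := j * m - q * k.
have k1tE : k * s + j = k1 * t.
  have -> : k1 * t = j * (k1 * m) - q * k1 * k by rewrite /t; ring.
  rewrite mediant_left.
  have -> : j * (m1 * k + 1) = (j * m1) * k + j by ring.
  by rewrite jm1E; ring.
have t_ge0 : 0 <= t.
  rewrite -(pmulr_rge0 _ k1_gt0) -k1tE; rewrite addr_ge0 // mulr_ge0 //.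
  by rewrite /k; lia.
have t_lt : t < k.
  rewrite -(ltr_pM2l k1_gt0) -k1tE /k; nia.
have jmE : j * m = q * k + t by rewrite /t; ring.
have [quoE remE] := euclid_unique q t_ge0 t_lt.
by exists t; rewrite jmE quoE remE.
Qed.

(** The endpoint [i = k2] is included: there [u = -1] and the remainder is 0,
    which is why the floor formula extends one step beyond the range of the
    direction indices of [(m2, k2)]. *)
Lemma mediant_right_division (i : int) : 0 <= i -> i <= k2 ->
  exists u : int, [/\ k * dir_index m2 k2 i - i = k2 * u,
    ((k1 + i) * m %/ k)%Z = m1 + (i * m2 %/ k2)%Z
    & dir_index m k (k1 + i) = 1 + u].
Proof.
move=> i_ge0 i_le; rewrite /dir_index.
have := divz_eq (i * m2) k2; have := modz_ge0 (i * m2) (lt0r_neq0 k2_gt0).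
have := ltz_pmod (i * m2) k2_gt0.
move: (_ %/ k2)%Z (_ %% k2)%Z => q s s_lt s_ge0 im2E.
pose u := i * m - q * k.
have k2uE : k * s - i = k2 * u.
  have -> : k2 * u = i * (k2 * m) - q * k2 * k by rewrite /u; ring.
  rewrite mediant_right.
  have -> : i * (m2 * k - 1) = (i * m2) * k - i by ring.
  by rewrite im2E; ring.
have k_gt : k2 < k by rewrite /k; lia.
have r_ge0 : 0 <= 1 + u.
  rewrite -(pmulr_rge0 _ k2_gt0) mulrDr mulr1 -k2uE.
  have : 0 <= k * s by rewrite mulr_ge0 //; lia.
  by lia.
have r_lt : 1 + u < k.
  rewrite -(ltr_pM2l k2_gt0) mulrDr mulr1 -k2uE.
  have : k * s <= k * (k2 - 1) by rewrite ler_wpM2l //; lia.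
  by lia.
have kimE : (k1 + i) * m = (m1 + q) * k + (1 + u).
  by rewrite mulrDl mediant_left /u; ring.
have [quoE remE] := euclid_unique (m1 + q) r_ge0 r_lt.
by exists u; rewrite kimE quoE remE.
Qed.

End Mediant.

Theorem lemma3p1 (m1 k1 m2 k2 m k : int)
  (adm1 : admissible m1 k1) (adm2 : admissible m2 k2)
  (lt12 : qratio m1 k1 < qratio m2 k2)
  (adj : farey_adjacent m1 k1 m2 k2)
  (def_m : m = m1 + m2) (def_k : k = k1 + k2) :
  (forall j : int, 0 <= j -> j <= k1 - 1 ->
     [/\ (k1 %| k * dir_index m1 k1 j + j)%Z,
         (dir_index m k j)%:Q = qratio (k * dir_index m1 k1 j + j) k1
       & Num.floor (qratio (j * m) k) = Num.floor (qratio (j * m1) k1)])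
  /\ (forall i : int, 0 <= i -> i <= k2 - 1 ->
        (k2 %| k * dir_index m2 k2 i - i)%Z
        /\ (dir_index m k (k1 + i))%:Q
           = 1 + qratio (k * dir_index m2 k2 i - i) k2)
  /\ (forall i : int, 0 <= i -> i <= k2 ->
        Num.floor (qratio ((k1 + i) * m) k) = m1 + Num.floor (qratio (i * m2) k2))
  /\ (k1 * m - m1 * k = m2 * k1 - m1 * k2 /\ m2 * k1 - m1 * k2 = 1).
Proof.
have k1_gt0 := admissible_gt0 adm1; have k2_gt0 := admissible_gt0 adm2.
have k_gt0 : 0 < k by rewrite def_k addr_gt0.
subst m k; split=> [j j_ge0 j_le|].
  have j_lt : j < k1 by lia.
  have [t [tE quoE remE]] := mediant_left_division k1_gt0 k2_gt0 adj j_ge0 j_lt.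
  by rewrite !floor_qratio // quoE remE tE qratio_mulKl // dvdz_mulr.
split=> [i i_ge0 i_le|].
  have i_le2 : i <= k2 by lia.
  have [u [uE _ remE]] :=
    mediant_right_division k1_gt0 k2_gt0 adj i_ge0 i_le2.
  by rewrite remE uE qratio_mulKl // dvdz_mulr // intrD.
split=> [i i_ge0 i_le|].
  have [u [_ quoE _]] := mediant_right_division k1_gt0 k2_gt0 adj i_ge0 i_le.
  by rewrite !floor_qratio.
by split; [ring | exact: adj].
Qed.
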